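(* Let $d\geqslant 1$. For every $r$ with $0\leqslant r<1$ there exists a real-valued function $f\in L^1(\mathbb{R}^d)$ such that $f(x)\geqslant f\star f(x)$ for almost every $x\in\mathbb{R}^d$, $\int_{\mathbb{R}^d} f(x)\,dx = \tfrac12$, and $$\int_{\mathbb{R}^d} |x|^r f(x)\,dx<\infty.$$
   Context: For $f\in L^1(\mathbb{R}^d)$, $f\star f(x) = \int_{\mathbb{R}^d} f(x-y)f(y)\,dy$ denotes the convolution of $f$ with itself. Every real integrable $f$ with $f\geqslant f\star f$ almost everywhere is non-negative almost everywhere, so the integral $\int_{\mathbb{R}^d}|x|^rf(x)\,dx$ is well defined in $[0,\infty]$. *)

(* Defs.v *)
From HB Require Import structures.
From mathcomp Require Import all_boot all_order all_algebra.
From mathcomp Require Import all_classical all_reals all_analysis.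

Set Implicit Arguments.
Unset Strict Implicit.
Unset Printing Implicit Defensive.

Import Order.TTheory GRing.Theory Num.Theory.
Import numFieldNormedType.Exports.

Local Open Scope classical_set_scope.
Local Open Scope ring_scope.

(** Points of R^d are the tuples [d.-tuple R]. The library equips them with the
    sigma-algebra generated by the coordinates, i.e. the Borel sets of R^d. *)

Section lebesgue_step.
Context (R : realType) (n : nat).
Local Open Scope ereal_scope.

Definition cons_tuple (p : measurableTypeR R * n.-tuple R) : n.+1.-tuple R :=
  [the n.+1.-tuple R of p.1 :: p.2].

Definition uncons_tuple (x : n.+1.-tuple R) : measurableTypeR R * n.-tuple R :=
  (thead x, [tuple of behead x]).

Lemma cons_tupleK : cancel cons_tuple uncons_tuple.
Proof. by case=> a b; rewrite /uncons_tuple theadE; congr pair; exact/val_inj. Qed.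

Lemma measurable_cons_tuple : measurable_fun setT cons_tuple.
Proof.
apply: (@measurable_cons _ _ (measurableTypeR R * n.-tuple R)%type R fst n snd).
  exact: measurable_fst.
exact: measurable_snd.
Qed.

Lemma measurable_uncons_tuple : measurable_fun setT uncons_tuple.
Proof.
apply: measurable_fun_pair; first exact: measurable_tnth.
exact: measurable_behead.
Qed.

Variable mu : {sigma_finite_measure set (n.-tuple R) -> \bar R}.

(** The product of Lebesgue measure on R and of [mu], seen on R^(n+1) through
    the identification of R x R^n with R^(n+1). *)
Definition lebesgue_step : set (n.+1.-tuple R) -> \bar R :=
  pushforward (@lebesgue_measure R \x mu) cons_tuple.

Let mpre A : measurable A -> measurable (cons_tuple @^-1` A).
Proof.
by move=> mA; rewrite -[X in measurable X]setTI; exact: measurable_cons_tuple.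
Qed.

Let lebesgue_step0 : lebesgue_step set0 = 0.
Proof. by rewrite /lebesgue_step /pushforward preimage_set0 measure0. Qed.

Let lebesgue_step_ge0 A : 0 <= lebesgue_step A.
Proof. by rewrite /lebesgue_step /pushforward; exact: measure_ge0. Qed.

Let lebesgue_step_sigma_additive : semi_sigma_additive lebesgue_step.
Proof.
move=> F mF tF mUF; rewrite /lebesgue_step /pushforward preimage_bigcup.
apply: measure_semi_sigma_additive.
- by move=> k; exact: mpre.
- apply/trivIsetP => /= i j _ _ ij; rewrite -preimage_setI.
  by move/trivIsetP : tF => /(_ _ _ _ _ ij) ->//; rewrite preimage_set0.
- by rewrite -preimage_bigcup; exact: mpre.
Qed.

HB.instance Definition _ := isMeasure.Build _ _ _ lebesgue_step
  lebesgue_step0 lebesgue_step_ge0 lebesgue_step_sigma_additive.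

Lemma lebesgue_step_preimage (C : set (measurableTypeR R * n.-tuple R)) :
  lebesgue_step (uncons_tuple @^-1` C) = (@lebesgue_measure R \x mu) C.
Proof.
rewrite /lebesgue_step /pushforward; congr (_ _).
by apply/seteqP; split=> p /=; rewrite cons_tupleK.
Qed.

Let lebesgue_step_sigma_finite : sigma_finite setT lebesgue_step.
Proof.
have /sigma_finiteP[F [TF ndF Foo]] := sigma_finiteT (@lebesgue_measure R).
have /sigma_finiteP[G [TG ndG Goo]] := sigma_finiteT mu.
exists (fun k => uncons_tuple @^-1` (F k `*` G k)).
  apply/seteqP; split=> // x _.
  have [i _ Fi] : (\bigcup_i F i) (uncons_tuple x).1 by rewrite -TF.
  have [j _ Gj] : (\bigcup_i G i) (uncons_tuple x).2 by rewrite -TG.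
  exists (maxn i j) => //; split.
    by move: Fi; exact/subsetPset/ndF/leq_maxl.
  by move: Gj; exact/subsetPset/ndG/leq_maxr.
move=> k; have [mF Fk] := Foo k; have [mG Gk] := Goo k; split.
  rewrite -[X in measurable X]setTI; apply: measurable_uncons_tuple => //.
  exact: measurableX.
rewrite lebesgue_step_preimage product_measure1E//.
by rewrite lte_mul_pinfty// ge0_fin_numE.
Qed.

HB.instance Definition _ := Measure_isSigmaFinite.Build _ _ _ lebesgue_step
  lebesgue_step_sigma_finite.

End lebesgue_step.

Section euclidean_space.
Context (R : realType).
Local Open Scope ereal_scope.

(** Lebesgue measure on R^d; R^0 is a point of mass 1. *)
Fixpoint lebesgue_tuple (d : nat) :
    {sigma_finite_measure set (d.-tuple R) -> \bar R} :=
  match d with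
  | 0 => @dirac _ (0.-tuple R) [tuple] R
  | d'.+1 => lebesgue_step (lebesgue_tuple d')
  end.

Lemma lebesgue_tuple_box (d : nat) (a b : 'I_d -> R) :
  (forall i, (a i <= b i)%R) ->
  lebesgue_tuple d [set x | forall i, tnth x i \in `[a i, b i]%R] =
  (\prod_(i < d) (b i - a i)%R)%:E.
Proof.
elim: d a b => [|d IH] a b ab.
  rewrite big_ord0 /= diracE mem_set// => -[]//.
pose A : set (measurableTypeR R) := [set` `[a ord0, b ord0]%R].
pose B := [set x : d.-tuple R | forall i,
  tnth x i \in `[a (lift ord0 i), b (lift ord0 i)]%R].
have -> : [set x : d.+1.-tuple R | forall i, tnth x i \in `[a i, b i]%R] =
    @uncons_tuple R d @^-1` (A `*` B).
  apply/seteqP; split => x /=.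
    move=> xab; split=> [|i]; first exact: xab.
    by have := xab (lift ord0 i); rewrite {1}(tuple_eta x) tnthS.
  case=> xA xB i; case: (unliftP ord0 i) => [j ->|->]; last exact: xA.
  by rewrite {1}(tuple_eta x) tnthS; exact: xB.
have mB : measurable B.
  rewrite (_ : B = \bigcap_(i in [set: 'I_d])
      ((fun x : d.-tuple R => tnth x i) @^-1`
       [set` `[a (lift ord0 i), b (lift ord0 i)]%R])); last first.
    by apply/seteqP; split => x /= xB i; [move=> _|]; exact: xB.
  apply: fin_bigcap_measurable; first exact: finite_finset.
  move=> i _; rewrite -[X in measurable X]setTI.
  by apply: measurable_tnth => //; exact: measurable_itv.
rewrite [LHS]lebesgue_step_preimage product_measure1E//; last first.
  exact: measurable_itv.
have lA : @lebesgue_measure R A = (b ord0 - a ord0)%:E.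
  rewrite /A lebesgue_measure_itv/= lte_fin.
  case: ltP => [_|ba]; first by rewrite -EFinB.
  by rewrite (_ : b ord0 = a ord0) ?subrr//; apply/le_anti; rewrite ba ab.
by rewrite big_ord_recl EFinM; congr (_ * _); [exact: lA|rewrite IH].
Qed.

Definition tuple_sub (d : nat) (x y : d.-tuple R) : d.-tuple R :=
  [tuple (tnth x i - tnth y i)%R | i < d].

Definition euclidean_norm (d : nat) (x : d.-tuple R) : R :=
  Num.sqrt (\sum_(i < d) tnth x i ^+ 2)%R.

(** For integrable [f] and [g] the integral is defined and finite for almost
    every [x] only, hence the extended real values. *)
Definition convolution (d : nat) (f g : d.-tuple R -> R) (x : d.-tuple R) :
    \bar R :=
  \int[lebesgue_tuple d]_y (f (tuple_sub x y) * g y)%:E.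

End euclidean_space.

(* Main.v *)
Require Import Defs.
From mathcomp Require Import all_boot all_order all_algebra.
From mathcomp Require Import all_classical all_reals all_analysis.
From mathcomp Require Import measurable_realfun ring lra.

(** If [f - f * f] is a quarter of the standard Gaussian density [p_1], then
    [f = (1 - sqrt(1 - p_1)) / 2] in the convolution algebra, that is
    [f = \sum_(n >= 1) c_n p_n] with [p_n] the Gaussian of variance [n] and
    [c_n] the coefficients of [(1 - sqrt(1 - z)) / 2]. These are positive, sum
    to 1/2 and are of order [n^(-3/2)], while the moment of order [r] of [p_n]
    is of order [n^(r/2)]; hence the moment of [f] is finite when [r < 1]. *)

Set Implicit Arguments.
Unset Strict Implicit.
Unset Printing Implicit Defensive.

Import Order.TTheory GRing.Theory Num.Theory.
Import numFieldNormedType.Exports.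

Local Open Scope classical_set_scope.
Local Open Scope ring_scope.

(* [catalan_weight n] is the coefficient of z^(n+1) in (1 - sqrt(1 - z)) / 2. *)
Fixpoint catalan_weight {R : realType} (n : nat) : R :=
  if n is m.+1 then catalan_weight m * ((2 * m%:R + 1) / (2 * m%:R + 4))
  else 4^-1.

Arguments catalan_weight {R} n : simpl never.

(** * Coefficients of (1 - sqrt(1 - z)) / 2: recurrence, convolution, sum and decay *)

Section catalan_weight.
Context {R : realType}.

Local Notation a := (@catalan_weight R).

Lemma catalan_weight_gt0 n : 0 < a n.
Proof.
elim: n => [|n IH]; first by rewrite invr_gt0.
by rewrite mulr_gt0// divr_gt0// ltr_wpDl// mulr_ge0.
Qed.

Lemma catalan_weight_ge0 n : 0 <= a n.
Proof. exact/ltW/catalan_weight_gt0. Qed.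

(** The recurrence cleared of denominators, a form in which [lra] can combine it with other
    identities. *)
Lemma catalan_weightS n : (n%:R + 2) * a n.+1 = (n%:R + 2^-1) * a n.
Proof.
have n0 : 0 <= n%:R :> R by [].
rewrite [a n.+1](_ : _ = a n * ((2 * n%:R + 1) / (2 * n%:R + 4)))//.
by field; rewrite gt_eqF//; lra.
Qed.

(* With [U n] the left-hand side, reversing the sum gives
   [2 * \sum_i (i + 1) a_i a_(n-i) = (n + 2) U n], and the recurrence of [a]
   turns this into one for [U]. *)
Lemma catalan_weight_convolution n :
  \sum_(i < n.+1) a i * a (n - i) = a n.+1.
Proof.
pose U n := \sum_(i < n.+1) a i * a (n - i).
have symU m : 2 * \sum_(i < m.+1) (i%:R + 1) * (a i * a (m - i)) =
    (m%:R + 2) * U m.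
  rewrite mulr2n mulrDl mul1r {2}(reindex_inj rev_ord_inj) /= -big_split /=.
  rewrite /U mulr_sumr; apply: eq_bigr => i _.
  have im : (i <= m)%N by rewrite -ltnS.
  rewrite subSS subKn// natrB//; ring.
rewrite -/(U n); elim: n => [|n IH].
  by rewrite /U big_ord1 /catalan_weight /=; field.
have n0 : 0 <= n%:R :> R by [].
(* After the term [i = 0] is split off, (i + 2) a_(i+1) = (i + 1/2) a_i = ((i + 1) - 1/2) a_i, and
   [symU n] evaluates the sum weighted by i + 1. With the induction hypothesis this gives (n + 3)
   U_(n+1) = (n + 3/2) a_(n+1) = (n + 3) a_(n+2). *)
have recU : 2 * \sum_(i < n.+2) (i%:R + 1) * (a i * a (n.+1 - i)) =
    2 * (4^-1 * a n.+1 + (n%:R + 1) / 2 * U n).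
  rewrite big_ord_recl /= subn0 add0r mul1r; congr (_ * (_ + _)).
  transitivity (\sum_(i < n.+1) ((i%:R + 1) * (a i * a (n - i))
      - 2^-1 * (a i * a (n - i)))).
    apply: eq_bigr => i _; rewrite /bump/= add1n subSS -[i.+1%:R]natr1.
    have := catalan_weightS i; rewrite -/(a i.+1) => h.
    have -> : (i%:R + 1 + 1) * (a i.+1 * a (n - i)) =
      ((i%:R + 2) * a i.+1) * a (n - i) by ring.
    by rewrite h; field.
  rewrite sumrB -mulr_sumr -/(U n); have := symU n; lra.
have n3 : n%:R + 3 != 0 :> R by rewrite gt_eqF//; lra.
apply: (mulfI n3).
have := symU n.+1; rewrite -[n.+1%:R]natr1 => h.
have -> : (n%:R + 3) * U n.+1 = (n%:R + 1 + 2) * U n.+1 by congr (_ * _); ring.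
rewrite -h recU IH.
have := catalan_weightS n.+1; rewrite -[n.+1%:R]natr1 => h2; lra.
Qed.

(** The sum telescopes: by the recurrence, a_n = 2 (n + 1) a_n - 2 (n + 2) a_(n+1). The subtracted
    term is thus the tail of a series of sum 1/2 once it is known to vanish. *)
Lemma sum_catalan_weight n :
  \sum_(0 <= i < n) a i = 2^-1 - 2 * (n%:R + 1) * a n.
Proof.
elim: n => [|n IH]; first by rewrite big_nil /catalan_weight; field.
rewrite big_nat_recr//= IH -/(a n.+1) -natr1.
have := catalan_weightS n; lra.
Qed.

(** Decay of the tail u_n = 2 (n + 1) a_n at rate n^(-1/2). Since u_(n+1) = u_n (2n + 1) / (2n + 2),
    the left-hand side is nonincreasing because (2n + 1) (2n + 3) <= (2n + 2)^2; it starts at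
    1/4. *)
Lemma catalan_weight_sqr_le n :
  (2 * (n%:R + 1) * a n) ^+ 2 * (2 * n%:R + 1) <= 4^-1.
Proof.
elim: n => [|n IH]; first by rewrite /catalan_weight expr2; lra.
apply: le_trans IH.
have n0 : 0 <= n%:R :> R by [].
have -> : 2 * (n.+1%:R + 1) * a n.+1 = (2 * n%:R + 1) * a n.
  by rewrite -[n.+1%:R]natr1; have := catalan_weightS n; lra.
rewrite -[n.+1%:R]natr1 -subr_ge0; set b := a n.
have -> : (2 * (n%:R + 1) * b) ^+ 2 * (2 * n%:R + 1) -
    ((2 * n%:R + 1) * b) ^+ 2 * (2 * (n%:R + 1) + 1) =
  b ^+ 2 * (2 * n%:R + 1) by ring.
by rewrite mulr_ge0 ?sqr_ge0//; lra.
Qed.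

Lemma cvg_sum_catalan_weight :
  (\sum_(0 <= i < n) a i) @[n --> \oo] --> (2^-1 : R).
Proof.
under eq_fun do rewrite sum_catalan_weight.
suff : (2^-1 - 2 * (n%:R + 1) * a n) @[n --> \oo] --> (2^-1 - 0 : R).
  by rewrite subr0.
apply: cvgB; first exact: cvg_cst.
(* As n + 1 <= 2n + 1, the decay estimate gives u_n^2 <= 1 / (n + 1), which is [harmonic n]. *)
apply: (@squeeze_cvgr _ _ _ _ (fun=> 0) (fun n => Num.sqrt (harmonic n : R))).
- near=> n; have n0 : 0 <= n%:R :> R by [].
  have u0 : 0 <= 2 * (n%:R + 1) * a n.
    by rewrite mulr_ge0 ?catalan_weight_ge0//; lra.
  rewrite u0 /= -[leLHS]ger0_norm// -sqrtr_sqr ler_wsqrtr//.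
  have := catalan_weight_sqr_le n.
  set u := (X in X ^+ 2); move=> h.
  rewrite /harmonic/= -[leRHS]mul1r ler_pdivlMr// -[n.+1%:R]natr1.
  have := sqr_ge0 u; nra.
- exact: cvg_cst.
- rewrite -(@sqrtr0 R); apply: continuous_cvg; last exact: cvg_harmonic.
  exact: sqrt_continuous.
Unshelve. all: by end_near. Qed.

(** Concavity of the logarithm gives (t + 1)^s <= t^s exp(s / t), and 1 - s / t <= exp(- s / t)
    cancels the exponential. *)
Lemma powR_succ_le (t s : R) : 0 < t -> 0 <= s -> s < t ->
  (t + 1) `^ s * (1 - s / t) <= t `^ s.
Proof.
move=> t0 s0 st.
have t1 : 0 < t + 1 by lra.
have lnle : ln (t + 1) <= ln t + t^-1.
  have -> : t + 1 = t * (1 + t^-1) by rewrite mulrDr divff ?gt_eqF// mulr1.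
  rewrite lnM ?posrE//; last by rewrite ltr_pwDl// invr_ge0 ltW.
  by rewrite lerD2l le_ln1Dx// (@lt_trans _ _ 0)// invr_gt0.
rewrite /powR !gt_eqF//; apply: (@le_trans _ _ (expR (s * (ln t + t^-1)) * (1 - s / t))).
  rewrite ler_wpM2r ?ler_expR ?ler_wpM2l// subr_ge0 ler_pdivrMr//; lra.
rewrite (mulrDr s) expRD -mulrA ler_piMr ?expR_ge0//.
apply: (@le_trans _ _ (expR (s / t) * expR (- (s / t)))).
  by rewrite ler_wpM2l ?expR_ge0// expR_ge1Dx.
by rewrite expRxMexpNx_1.
Qed.

(* Raabe's test: [n + 1] times the [n]-th term decreases by at least
   [(1 - r) / 2] times that term. *)
Lemma sum_catalan_weight_powR_le (r : R) (n : nat) : 0 <= r -> r < 1 ->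
  \sum_(0 <= i < n) a i * (i%:R + 1) `^ (r / 2) <= (2 * (1 - r))^-1.
Proof.
move=> r0 r1; set q := fun i : nat => a i * (i%:R + 1) `^ (r / 2).
have q0 i : 0 <= q i by rewrite mulr_ge0 ?powR_ge0// catalan_weight_ge0.
have raabe i : (i%:R + 2) * q i.+1 <= (i%:R + 1 - (1 - r) / 2) * q i.
  have i0 : 0 <= i%:R :> R by [].
  rewrite /q mulrA catalan_weightS -[i.+1%:R]natr1.
  have := @powR_succ_le (i%:R + 1) (r / 2).
  set P := (_ + 1 + 1) `^ _; set Q := (_ + 1) `^ _; set t := i%:R + 1.
  have t1 : 1 <= t by rewrite /t; lra.
  move=> /(_ ltac:(lra) ltac:(lra) ltac:(lra)) h.
  have Pge : 0 <= P by exact: powR_ge0.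
  (* Since (1 - r) / 2 + r / 2 = 1/2, the product expands to t - 1/2 = i + 1/2 plus a nonnegative
     remainder. *)
  have e : i%:R + 2^-1 <= (t - (1 - r) / 2) * (1 - r / 2 / t).
    have -> : (t - (1 - r) / 2) * (1 - r / 2 / t) =
      t - 2^-1 + (1 - r) / 2 * (r / 2 / t) by field; lra.
    have : 0 <= (1 - r) / 2 * (r / 2 / t) by rewrite !mulr_ge0// ?invr_ge0; lra.
    rewrite /t; lra.
  have a0 := catalan_weight_gt0 i.
  have key : (i%:R + 2^-1) * P <= (t - (1 - r) / 2) * Q.
    apply: (le_trans (ler_wpM2r Pge e)).
    rewrite -[leLHS]mulrA ler_wpM2l//; [rewrite /t; lra|by rewrite mulrC].
  by have := ler_wpM2l (ltW a0) key; lra.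
(* Raabe's inequality bounds (1 - r) / 2 times each term by a telescoping difference; 1/4 is the
   initial value 1 * q_0 = a_0. *)
have : (1 - r) / 2 * \sum_(0 <= i < n) q i <= 4^-1 - (n%:R + 1) * q n.
  elim: n => [|n IH].
    rewrite big_nil mulr0 add0r mul1r /q /catalan_weight add0r powR1; lra.
  rewrite big_nat_recr//= -[n.+1%:R]natr1; have := raabe n; lra.
move=> h; have n0 : 0 <= n%:R :> R by [].
have nq : 0 <= (n%:R + 1) * q n by rewrite mulr_ge0// addr_ge0.
rewrite invfM -ler_pdivrMr ?invr_gt0 ?subr_gt0// invrK; lra.
Qed.

(** The truncated form of f * f <= f, with q_(i+j) standing for the convolution of two Gaussians.
    Terms are grouped by k = i + j: the square i, j < n lies in the triangle i + j < 2n, and over a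
    full diagonal the products a_i a_(k-i) sum to a_(k+1). *)
Lemma sum_catalan_weight_convolution_le (q : nat -> R) (n : nat) : (forall k, 0 <= q k) ->
  \sum_(0 <= i < n) \sum_(0 <= j < n) a i * a j * q (i + j)%N <=
  \sum_(0 <= k < n + n) a k.+1 * q k.
Proof.
move=> q0; have a0 := catalan_weight_ge0.
apply: (@le_trans _ _ (\sum_(0 <= i < n) \sum_(0 <= k < n + n | (i <= k)%N)
    a i * a (k - i)%N * q k)).
  rewrite !big_mkord; apply: ler_sum => i _.
  rewrite -(@big_nat_widenl _ _ _ i 0%N (n + n) xpredT)//.
  rewrite [leRHS](_ : _ =
      \sum_(0 <= j < n + n - i) a i * a j * q (i + j)%N); last first.
    rewrite -{1}[nat_of_ord i]add0n big_addn.
    by apply: eq_bigr => j _; rewrite addnK addnC.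
  apply: nondecreasing_series.
    by move=> k _ _; rewrite !mulr_ge0.
  by rewrite -addnBA ?leq_addr// ltnW.
rewrite (exchange_big_dep_nat xpredT)//= !big_mkord; apply: ler_sum => k _.
rewrite -mulr_suml ler_wpM2r// -catalan_weight_convolution.
rewrite -[leRHS](big_mkord xpredT (fun i => a i * a (k - i)%N)).
(* The full diagonal [i < k.+1] may be shorter or longer than [i < n]; widened to [n + k.+1] under
   the filter [i <= k], it becomes a later partial sum of the same series. *)
rewrite (@big_nat_widen _ _ _ 0%N k.+1 (n + k.+1) xpredT) ?leq_addl//=.
apply: nondecreasing_series; last exact: leq_addr.
by move=> i _ _; rewrite mulr_ge0.
Qed.

End catalan_weight.

(** * Integrals over R^d of products of one-variable functions *)

Section product_integral.
Context {R : realType}.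
Local Open Scope ereal_scope.

Lemma measurable_prod_tnth (d : nat) (h : 'I_d -> R -> R) :
  (forall i, measurable_fun setT (h i)) ->
  measurable_fun setT (fun x : d.-tuple R => \prod_(i < d) h i (tnth x i))%R.
Proof.
move=> mh; apply: measurable_prod => i _.
by apply: (measurableT_comp (mh i)); exact: measurable_tnth.
Qed.

(** Induction on [d]: Lebesgue measure on R^(d+1) is the image of a product measure under
    [cons_tuple], so Tonelli splits off the first coordinate. *)
Lemma integral_lebesgue_tuple_prod (d : nat) (g : 'I_d -> R -> R) (A : 'I_d -> R) :
  (forall i, measurable_fun setT (g i)) -> (forall i x, (0 <= g i x)%R) ->
  (forall i, \int[lebesgue_measure]_x (g i x)%:E = (A i)%:E) ->
  \int[lebesgue_tuple R d]_x (\prod_(i < d) g i (tnth x i))%R%:E =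
  (\prod_(i < d) A i)%R%:E.
Proof.
elim: d g A => [|d IH] g A mg g0 gA.
  rewrite big_ord0 /=; under eq_integral do rewrite big_ord0.
  by rewrite integral_cst//= diracT mule1.
have -> : \int[lebesgue_tuple R d.+1]_x (\prod_(i < d.+1) g i (tnth x i))%R%:E =
  \int[@lebesgue_measure R \x lebesgue_tuple R d]_p
    ((g ord0 p.1)%:E * (\prod_(i < d) g (lift ord0 i) (tnth p.2 i))%R%:E).
  etransitivity.
    apply: (@ge0_integral_pushforward _ _ _ _ R (@Defs.cons_tuple R d)
      (@measurable_cons_tuple R d) (@lebesgue_measure R \x lebesgue_tuple R d) setT
      (fun x => (\prod_(i < d.+1) g i (tnth x i))%R%:E)) => //.
      by apply/measurable_EFinP; exact: measurable_prod_tnth.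
    by move=> y _; rewrite lee_fin prodr_ge0.
  rewrite preimage_setT; apply: eq_integral => p _ /=.
  rewrite big_ord_recl EFinM; congr ((_)%:E * (_)%:E).
  by apply: eq_bigr => i _; rewrite tnthS.
rewrite fubini_tonelli1/=; last 2 first.
- apply: emeasurable_funM.
    apply/measurable_EFinP.
    exact: (measurableT_comp (mg ord0) measurable_fst).
  apply/measurable_EFinP.
  apply: (measurableT_comp (@measurable_prod_tnth d (fun i => g (lift ord0 i)) _) measurable_snd).
  by move=> i; exact: mg.
- by move=> p; rewrite mule_ge0// lee_fin// prodr_ge0.
rewrite /fubini_F/=.
have gtail := IH _ _ (fun i => mg (lift ord0 i)) (fun i => g0 (lift ord0 i))
  (fun i => gA (lift ord0 i)).
under eq_integral => x _.
  rewrite ge0_integralZl//; last 3 first.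
  - by apply/measurable_EFinP; apply: (@measurable_prod_tnth d (fun i => g (lift ord0 i))) => i.
  - by move=> y _; rewrite lee_fin prodr_ge0.
  - by rewrite lee_fin.
  rewrite gtail; over.
rewrite ge0_integralZr//.
- by rewrite gA big_ord_recl EFinM.
- by apply/measurable_EFinP; exact: mg.
- by move=> x _; rewrite lee_fin.
(* The constant factor is nonnegative because it is the integral of a nonnegative function. *)
- rewrite -gtail.
  by apply: integral_ge0 => x _; rewrite lee_fin prodr_ge0.
Qed.

End product_integral.

(** * One-dimensional centred Gaussians indexed by their variance *)

Section normal_pdf_sqrt.
Context {R : realType}.
Implicit Types m s t u : R.

(** [normal_pdf] takes a standard deviation; passing [Num.sqrt t] makes [t] the variance, the
    parameter that adds up under convolution. *)
Lemma normal_pdf_sqrtE m t u : 0 < t -> normal_pdf m (Num.sqrt t) u =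
  (Num.sqrt (t * pi *+ 2))^-1 * expR (- (u - m) ^+ 2 / (t *+ 2)).
Proof.
move=> t0; rewrite normal_pdfE ?gt_eqF ?sqrtr_gt0//.
by rewrite /normal_peak /normal_fun sqr_sqrtr// ltW.
Qed.

Lemma normal_pdf_sqrt_le1 m t u : 1 <= t -> normal_pdf m (Num.sqrt t) u <= 1.
Proof.
move=> t1; have t0 : 0 < t by rewrite (lt_le_trans _ t1).
apply: (le_trans (normal_pdf_ub _ _ _)); first by rewrite gt_eqF ?sqrtr_gt0.
rewrite /normal_peak sqr_sqrtr ?(ltW t0)// invf_le1 ?sqrtr_gt0.
  rewrite -[leLHS](@sqrtr1 R) ler_wsqrtr//.
  have := @pi_ge2 R; rewrite -mulr_natr; nra.
by rewrite pmulrn_lgt0// mulr_gt0// pi_gt0.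
Qed.

(* Completing the square in [y]. *)
Lemma normal_pdf_mul s t x y : 0 < s -> 0 < t ->
  normal_pdf 0 (Num.sqrt s) (x - y) * normal_pdf 0 (Num.sqrt t) y =
  normal_pdf 0 (Num.sqrt (s + t)) x *
  normal_pdf (t / (s + t) * x) (Num.sqrt (s * t / (s + t))) y.
Proof.
move=> s0 t0; have st0 : 0 < s + t by rewrite addr_gt0.
have p0 := @pi_gt0 R.
have pk u : 0 < u -> 0 <= u * pi *+ 2 :> R.
  by move=> u0; rewrite mulrn_wge0// mulr_ge0// ltW.
rewrite !normal_pdf_sqrtE ?divr_gt0 ?mulr_gt0// mulrACA [RHS]mulrACA.
rewrite -!invfM -!sqrtrM ?pk// -!expRD; congr ((Num.sqrt _)^-1 * expR _).
  by field; rewrite gt_eqF.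
by field; rewrite !gt_eqF.
Qed.

(** Half of the exponent u^2 / (2t) suffices for the Gaussian of variance 2t; the other half is kept
    as a factor able to absorb a power of u. *)
Lemma normal_pdf_double t u : 0 < t -> normal_pdf 0 (Num.sqrt t) u =
  Num.sqrt 2 * normal_pdf 0 (Num.sqrt (2 * t)) u * expR (- (u ^+ 2 / (4 * t))).
Proof.
move=> t0; rewrite !normal_pdf_sqrtE ?mulr_gt0//.
have p0 := @pi_gt0 R.
have -> : 2 * t * pi *+ 2 = 2 * (t * pi *+ 2) by ring.
rewrite sqrtrM// invfM !mulrA divff ?gt_eqF ?sqrtr_gt0// mul1r -mulrA -expRD.
by congr (_ * expR _); field; rewrite gt_eqF.
Qed.

End normal_pdf_sqrt.

(** * Gaussians on R^d: convolution semigroup and moment bounds *)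

Section gauss_kernel.
Context {R : realType}.
Implicit Types r s t : R.

Definition gauss_kernel (d : nat) (t : R) (x : d.-tuple R) : R :=
  \prod_(i < d) normal_pdf 0 (Num.sqrt t) (tnth x i).

Lemma gauss_kernel_ge0 d t (x : d.-tuple R) : 0 <= gauss_kernel t x.
Proof. by apply: prodr_ge0 => i _; exact: normal_pdf_ge0. Qed.

Lemma gauss_kernel_le1 d t (x : d.-tuple R) : 1 <= t -> gauss_kernel t x <= 1.
Proof.
by move=> t1; apply: prodr_ile1 => i _; rewrite normal_pdf_ge0 normal_pdf_sqrt_le1.
Qed.

Lemma measurable_gauss_kernel d t :
  measurable_fun setT (@gauss_kernel d t).
Proof.
by apply: (measurable_prod_tnth (h := fun=> normal_pdf 0 (Num.sqrt t))) => i;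
  exact: measurable_normal_pdf.
Qed.

Lemma measurable_gauss_kernel_sub d t (x : d.-tuple R) :
  measurable_fun setT (fun y => gauss_kernel t (tuple_sub x y)).
Proof.
rewrite (_ : (fun _ => _) = fun y : d.-tuple R =>
    \prod_(i < d) (fun u => normal_pdf 0 (Num.sqrt t) (tnth x i - u)) (tnth y i)).
  apply: (measurable_prod_tnth (h := fun i u => normal_pdf 0 (Num.sqrt t) (tnth x i - u))) => i.
  apply: (measurableT_comp (measurable_normal_pdf _ _)).
  exact: measurable_funB.
by apply/funext => y; apply: eq_bigr => i _; rewrite tnth_mktuple.
Qed.

Lemma integral_gauss_kernel d t :
  (\int[lebesgue_tuple R d]_x (gauss_kernel t x)%:E = 1)%E.
Proof.
rewrite (integral_lebesgue_tuple_prod (g := fun=> normal_pdf 0 (Num.sqrt t))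
  (A := fun=> 1)).
- by rewrite big1.
- by move=> _; exact: measurable_normal_pdf.
- by move=> _ x; exact: normal_pdf_ge0.
- by move=> _; exact: integral_normal_pdf.
Qed.

Lemma gauss_kernel_convolution d s t (x : d.-tuple R) : 0 < s -> 0 < t ->
  (convolution (gauss_kernel s) (gauss_kernel t) x = (gauss_kernel (s + t) x)%:E)%E.
Proof.
move=> s0 t0; rewrite /convolution.
(* After completing the square, [y] occurs only in a normal density of mass 1, so [g i] integrates
   to its first factor. *)
pose g (i : 'I_d) y := normal_pdf 0 (Num.sqrt (s + t)) (tnth x i) *
  normal_pdf (t / (s + t) * tnth x i) (Num.sqrt (s * t / (s + t))) y.
rewrite -(integral_lebesgue_tuple_prod (g := g)).
- apply: eq_integral => y _; congr EFin; rewrite -big_split; apply: eq_bigr => i _.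
  by rewrite /= tnth_mktuple normal_pdf_mul.
- by move=> i; apply: measurable_funM => //; exact: measurable_normal_pdf.
- by move=> i y; rewrite mulr_ge0// normal_pdf_ge0.
- move=> i; under eq_integral do rewrite EFinM.
  rewrite ge0_integralZl//.
  + by rewrite integral_normal_pdf mule1.
  + by apply/measurable_EFinP; exact: measurable_normal_pdf.
  + by move=> y _; rewrite lee_fin normal_pdf_ge0.
  + by rewrite lee_fin normal_pdf_ge0.
Qed.

(** With v = |x|^2 / (4t), doubling the variance in every coordinate leaves a factor exp(-v), and v
    exp(-v) <= 1. The bound is a multiple of a probability density, hence easy to integrate. *)
Lemma sqr_norm_gauss_kernel_le d t (x : d.-tuple R) : 0 < t ->
  euclidean_norm x ^+ 2 * gauss_kernel t x <=
  4 * t * Num.sqrt 2 ^+ d * gauss_kernel (2 * t) x.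
Proof.
move=> t0; have t4 : 0 < 4 * t by rewrite mulr_gt0.
pose v := euclidean_norm x ^+ 2 / (4 * t).
have vE : v = \sum_(i < d) tnth x i ^+ 2 / (4 * t).
  by rewrite /v sqr_sqrtr ?mulr_suml// sumr_ge0// => i _; exact: sqr_ge0.
have -> : gauss_kernel t x =
    Num.sqrt 2 ^+ d * gauss_kernel (2 * t) x * expR (- v).
  rewrite /gauss_kernel; under eq_bigr do rewrite normal_pdf_double//.
  rewrite !big_split/= prodr_const card_ord; congr (_ * _).
  by rewrite vE -sumrN expR_sum.
have -> : euclidean_norm x ^+ 2 = 4 * t * v by rewrite mulrC divfK// gt_eqF.
have ve : v * expR (- v) <= 1.
  have v1 : v <= expR v by have := expR_ge1Dx v; lra.
  by rewrite -(expRxMexpNx_1 v) ler_wpM2r ?expR_ge0.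
set c := Num.sqrt 2 ^+ d; set p := gauss_kernel _ _.
have -> : 4 * t * v * (c * p * expR (- v)) = 4 * t * c * p * (v * expR (- v)).
  by ring.
by rewrite ler_piMr// !mulr_ge0 ?gauss_kernel_ge0 ?exprn_ge0 ?(ltW t0).
Qed.

Lemma powR_le1Dsqr (u r : R) : 0 <= u -> 0 <= r -> r <= 2 -> u `^ r <= 1 + u ^+ 2.
Proof.
move=> u0 r0 r2; have [u1|u1] := leP u 1.
  apply: (@le_trans _ _ (1 `^ r)); last by rewrite powR1 lerDl sqr_ge0.
  by rewrite ge0_ler_powR// nnegrE.
apply: (@le_trans _ _ (u `^ 2)); first by rewrite ler_powR// ltW.
by rewrite powR_mulrn// lerDr.
Qed.

(** Rescaling by sqrt(t) extracts t^(r/2); the remaining power of |x| / sqrt(t) is at most 1 + |x|^2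
    / t, to which the second-moment bound applies. *)
Lemma powR_norm_gauss_kernel_le d t r (x : d.-tuple R) :
  0 < t -> 0 <= r -> r <= 2 ->
  euclidean_norm x `^ r * gauss_kernel t x <= t `^ (r / 2) *
  (gauss_kernel t x + 4 * Num.sqrt 2 ^+ d * gauss_kernel (2 * t) x).
Proof.
move=> t0 r0 r2.
have st0 : 0 < Num.sqrt t by rewrite sqrtr_gt0.
have n0 : 0 <= euclidean_norm x by exact: sqrtr_ge0.
have un0 : 0 <= euclidean_norm x / Num.sqrt t by rewrite divr_ge0// ltW.
have -> : euclidean_norm x `^ r =
    t `^ (r / 2) * (euclidean_norm x / Num.sqrt t) `^ r.
  rewrite (mulrC r) powRrM powR12_sqrt ?(ltW t0)// -powRM ?(ltW st0)//.
  by rewrite mulrC divfK// gt_eqF.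
rewrite -mulrA ler_wpM2l ?powR_ge0//.
have p0 := gauss_kernel_ge0 t x.
apply: (le_trans (ler_wpM2r p0 (powR_le1Dsqr un0 r0 r2))).
rewrite mulrDl mul1r lerD2l expr_div_n (sqr_sqrtr (ltW t0)) mulrAC ler_pdivrMr//.
apply: (le_trans (sqr_norm_gauss_kernel_le x t0)).
by rewrite le_eqVlt; apply/orP; left; apply/eqP; ring.
Qed.

End gauss_kernel.

(** * The weighted sum of Gaussians: mass, moment and convolution inequality *)

Section catalan_mixture.
Context {R : realType} (d : nat).
Implicit Type x : d.-tuple R.

Local Notation a := (@catalan_weight R).
(** The coefficient [a n] of z^(n+1) goes with variance n + 1, so the convolution of [p i] and [p j]
    is [p (i + j).+1]. *)
Local Notation p n := (@gauss_kernel R d (n%:R + 1)).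

Definition mixture_sum (n : nat) x : R := \sum_(0 <= i < n) a i * p i x.

Definition mixture x : R := limn (mixture_sum ^~ x).

Let term_ge0 i x : 0 <= a i * p i x.
Proof. by rewrite mulr_ge0 ?gauss_kernel_ge0// catalan_weight_ge0. Qed.

Lemma mixture_sum_ge0 n x : 0 <= mixture_sum n x.
Proof. by rewrite /mixture_sum big_mkord; apply: sumr_ge0 => i _. Qed.

Lemma nondecreasing_mixture_sum x : nondecreasing_seq (mixture_sum ^~ x).
Proof. by apply: nondecreasing_series => i _ _. Qed.

(** All variances are at least 1, so the kernels are bounded by 1, and the weights sum to at most
    1/2. With monotonicity this makes [mixture] a true real limit at every point. *)
Lemma mixture_sum_le1 n x : mixture_sum n x <= 1.
Proof.
apply: (@le_trans _ _ (\sum_(0 <= i < n) a i)).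
  rewrite /mixture_sum !big_mkord; apply: ler_sum => i _.
  rewrite ler_piMr ?catalan_weight_ge0// gauss_kernel_le1//.
  by rewrite lerDr.
rewrite sum_catalan_weight.
have : 0 <= 2 * (n%:R + 1) * a n by rewrite !mulr_ge0// catalan_weight_ge0.
lra.
Qed.

Lemma cvg_mixture_sum x : mixture_sum n x @[n --> \oo] --> mixture x.
Proof.
apply: nondecreasing_is_cvgn; first exact: nondecreasing_mixture_sum.
by exists 1 => _ [n _ <-]; exact: mixture_sum_le1.
Qed.

Lemma mixture_sum_le n x : mixture_sum n x <= mixture x.
Proof.
apply: nondecreasing_cvgn_le; first exact: nondecreasing_mixture_sum.
exact: cvg_mixture_sum.
Qed.

Lemma mixture_ge0 x : 0 <= mixture x.
Proof. exact: le_trans (mixture_sum_ge0 0 x) (mixture_sum_le 0 x). Qed.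

Lemma measurable_mixture_sum n : measurable_fun setT (mixture_sum n).
Proof.
apply: measurable_sum => i; apply: measurable_funM => //.
exact: measurable_gauss_kernel.
Qed.

Lemma measurable_mixture : measurable_fun setT mixture.
Proof.
apply: (measurable_fun_cvg measurable_mixture_sum) => x _.
exact: cvg_mixture_sum.
Qed.

Local Open Scope ereal_scope.

Lemma mixture_series x : (mixture x)%:E = \sum_(0 <= i <oo) (a i * p i x)%:E.
Proof.
apply/esym/cvg_lim => //; under eq_fun do rewrite sumEFin.
by apply: cvg_EFin; [exact: nearW|exact: cvg_mixture_sum].
Qed.

(** Sum and integral are interchanged by nonnegativity. The weight [w] serves both the total mass,
    with [w] equal to 1, and the moment, with [w] equal to |x|^r. *)
Lemma integral_mixture (w : d.-tuple R -> R) : measurable_fun setT w ->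
  (forall x, (0 <= w x)%R) ->
  \int[lebesgue_tuple R d]_x (w x * mixture x)%:E =
  \sum_(0 <= i <oo) (a i)%:E * \int[lebesgue_tuple R d]_x (w x * p i x)%:E.
Proof.
move=> mw w0.
have mwp i : measurable_fun setT (fun x => (w x * p i x)%:E).
  by apply/measurable_EFinP/measurable_funM => //; exact: measurable_gauss_kernel.
have wp0 i x : 0 <= (w x * p i x)%:E.
  by rewrite lee_fin mulr_ge0// gauss_kernel_ge0.
have a0 i : (0 <= a i)%R by rewrite catalan_weight_ge0.
transitivity (\int[lebesgue_tuple R d]_x
    (\sum_(0 <= i <oo) ((a i)%:E * (w x * p i x)%:E))).
  apply: eq_integral => x _; rewrite EFinM mixture_series -nneseriesZl; last first.
    by move=> i _; rewrite lee_fin.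
  by apply: eq_eseriesr => i _; rewrite -!EFinM mulrCA.
rewrite integral_nneseries//.
- by apply: eq_eseriesr => i _; rewrite ge0_integralZl// lee_fin.
- by move=> i; apply: emeasurable_funM.
- by move=> i x _; rewrite mule_ge0// lee_fin.
Qed.

Lemma integral_mixture_half :
  \int[lebesgue_tuple R d]_x (mixture x)%:E = (2^-1)%:E.
Proof.
under eq_integral do rewrite -[mixture _]mul1r.
rewrite (integral_mixture (w := cst 1%R))//.
under eq_eseriesr => i _.
  under eq_integral do rewrite mul1r.
  rewrite integral_gauss_kernel mule1; over.
apply/cvg_lim => //; under eq_fun do rewrite sumEFin.
by apply: cvg_EFin; [exact: nearW|exact: cvg_sum_catalan_weight].
Qed.

Lemma integral_powR_norm_mixture_lty (r : R) : (0 <= r)%R -> (r < 1)%R ->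
  \int[lebesgue_tuple R d]_x (euclidean_norm x `^ r * mixture x)%:E < +oo.
Proof.
move=> r0 r1.
have mnorm : measurable_fun setT (fun x : d.-tuple R => euclidean_norm x `^ r)%R.
  apply: (measurableT_comp (measurable_powR _)).
  apply: (measurableT_comp (continuous_measurable_fun (@sqrt_continuous R))).
  apply: measurable_sum => i; apply: measurable_funX; exact: measurable_tnth.
rewrite integral_mixture//; last by move=> x; exact: powR_ge0.
(* [K] is the mass of the sum of kernels that dominates |x|^r [p i], once the factor (i + 1)^(r/2)
   is taken out. *)
pose K : R := (1 + 4 * Num.sqrt 2 ^+ d)%R.
have K0 : (0 <= K)%R by rewrite addr_ge0// mulr_ge0// exprn_ge0.
have mg t : measurable_fun setT (fun x : d.-tuple R => (gauss_kernel t x)%:E).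
  by apply/measurable_EFinP; exact: measurable_gauss_kernel.
have moment i : \int[lebesgue_tuple R d]_x (euclidean_norm x `^ r * p i x)%:E <=
    ((i%:R + 1) `^ (r / 2) * K)%:E.
  apply: (@le_trans _ _ (\int[lebesgue_tuple R d]_x
    (((i%:R + 1) `^ (r / 2))%:E * ((gauss_kernel (i%:R + 1) x)%:E +
      (4 * Num.sqrt 2 ^+ d)%:E * (gauss_kernel (2 * (i%:R + 1)) x)%:E)))).
    apply: ge0_le_integral => //.
    - by move=> x _; rewrite lee_fin mulr_ge0 ?powR_ge0 ?gauss_kernel_ge0.
    - by apply/measurable_EFinP/measurable_funM => //; exact: measurable_gauss_kernel.
    - by apply: emeasurable_funM => //; apply: emeasurable_funD => //;
        exact: emeasurable_funM.
    - by move=> x _; rewrite lee_fin; apply: powR_norm_gauss_kernel_le => //; lra.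
  have g0 t x : 0 <= (gauss_kernel t x)%:E by rewrite lee_fin gauss_kernel_ge0.
  have c0 : 0 <= (4 * Num.sqrt 2 ^+ d : R)%:E.
    by rewrite lee_fin mulr_ge0// exprn_ge0.
  rewrite ge0_integralZl//; last 2 first.
  - by apply: emeasurable_funD => //; exact: emeasurable_funM.
  - by move=> x _; rewrite adde_ge0// mule_ge0.
  rewrite ge0_integralD//; last 2 first.
  - by move=> x _; rewrite mule_ge0.
  - exact: emeasurable_funM.
  by rewrite ge0_integralZl// !integral_gauss_kernel mule1.
(* The weighted series of (i + 1)^(r/2) is at most 1 / (2 (1 - r)); this is where r < 1 enters. *)
apply: (@le_lt_trans _ _ (K * (2 * (1 - r))^-1)%:E); last exact: ltry.
apply: (@le_trans _ _ (\sum_(0 <= i <oo) (a i * ((i%:R + 1) `^ (r / 2) * K))%:E)).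
  apply: lee_nneseries => i _; last first.
    rewrite EFinM; apply: lee_wpmul2l => //.
    by rewrite lee_fin catalan_weight_ge0.
  move=> _; rewrite mule_ge0//; first by rewrite lee_fin catalan_weight_ge0.
  apply: integral_ge0 => x _.
  by rewrite lee_fin mulr_ge0 ?powR_ge0 ?gauss_kernel_ge0.
apply: lime_le.
  apply: is_cvg_nneseries => i _ _.
  by rewrite lee_fin !mulr_ge0 ?powR_ge0// catalan_weight_ge0.
apply: nearW => n; rewrite sumEFin lee_fin.
under eq_bigr do rewrite mulrA.
by rewrite -mulr_suml mulrC ler_wpM2l// sum_catalan_weight_powR_le.
Qed.

(** Truncation keeps the expansion of the convolution a finite double sum, to which the semigroup
    law and the regrouping by i + j apply. *)
Lemma mixture_sum_convolution_le n x :
  convolution (mixture_sum n) (mixture_sum n) x <= (mixture x)%:E.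
Proof.
have a0 := @catalan_weight_ge0 R.
have pp i j : convolution (p i) (p j) x = (p (i + j).+1 x)%:E.
  rewrite gauss_kernel_convolution ?ltr_wpDl//; congr (gauss_kernel _ _)%:E.
  by rewrite -[(i + j).+1%:R]natr1 natrD; ring.
have mpp i j : measurable_fun setT (fun y => (p i (tuple_sub x y) * p j y)%:E).
  apply/measurable_EFinP/measurable_funM.
    exact: measurable_gauss_kernel_sub.
  exact: measurable_gauss_kernel.
have pp0 i j y : 0 <= (p i (tuple_sub x y) * p j y)%:E.
  by rewrite lee_fin mulr_ge0// gauss_kernel_ge0.
have -> : convolution (mixture_sum n) (mixture_sum n) x =
    (\sum_(0 <= i < n) \sum_(0 <= j < n) a i * a j * p (i + j).+1 x)%R%:E.
  rewrite /convolution.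
  transitivity (\int[lebesgue_tuple R d]_y (\sum_(0 <= i < n) \sum_(0 <= j < n)
      (a i * a j)%:E * (p i (tuple_sub x y) * p j y)%:E)).
    apply: eq_integral => y _; rewrite /mixture_sum mulr_suml -sumEFin.
    apply: eq_bigr => i _; rewrite mulr_sumr -sumEFin; apply: eq_bigr => j _.
    by rewrite -EFinM mulrACA.
  rewrite ge0_integral_sum//; last 2 first.
  - by move=> i; apply: emeasurable_sum => j; exact: emeasurable_funM.
  - by move=> i y _; apply: sume_ge0 => j _; rewrite mule_ge0// lee_fin mulr_ge0.
  rewrite -sumEFin; apply: eq_bigr => i _.
  rewrite ge0_integral_sum//; last 2 first.
  - by move=> j; exact: emeasurable_funM.
  - by move=> j y _; rewrite mule_ge0// lee_fin mulr_ge0.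
  rewrite -sumEFin; apply: eq_bigr => j _.
  by rewrite ge0_integralZl ?lee_fin ?mulr_ge0//= [X in _ * X]pp.
rewrite lee_fin.
apply: (le_trans (@sum_catalan_weight_convolution_le _ (fun k => p k.+1 x) n _)).
  by move=> k; exact: gauss_kernel_ge0.
(* The sum reached is [mixture_sum (n + n).+1] without its first term, the quarter Gaussian by which
   f exceeds f * f. *)
apply: le_trans (mixture_sum_le (n + n).+1 x).
by rewrite /mixture_sum big_nat_recl// lerDr mulr_ge0// gauss_kernel_ge0.
Qed.

(** Monotone convergence in the truncated inequality: both factors of the integrand are nonnegative
    and nondecreasing in [n], while the upper bound does not depend on [n]. *)
Lemma mixture_convolution_le x : convolution mixture mixture x <= (mixture x)%:E.
Proof.
pose g n y := (mixture_sum n (tuple_sub x y) * mixture_sum n y)%:E.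
have mg n : measurable_fun setT (g n).
  apply/measurable_EFinP/measurable_funM; last exact: measurable_mixture_sum.
  apply: measurable_sum => i; apply: measurable_funM => //.
  exact: measurable_gauss_kernel_sub.
have g0 n y : setT y -> 0 <= g n y.
  by move=> _; rewrite lee_fin mulr_ge0// mixture_sum_ge0.
have ndg y : setT y -> nondecreasing_seq (g ^~ y).
  move=> _ m n mn; rewrite lee_fin ler_pM// ?mixture_sum_ge0//;
    exact: nondecreasing_mixture_sum.
have -> : convolution mixture mixture x =
    \int[lebesgue_tuple R d]_y limn (g ^~ y).
  apply: eq_integral => y _; apply/esym/cvg_lim => //.
  apply: cvg_EFin; first exact: nearW.
  by apply: cvgM; exact: cvg_mixture_sum.
rewrite monotone_convergence//; apply: lime_le.
  apply: ereal_nondecreasing_is_cvgn => m n mn.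
  by apply: ge0_le_integral => // y _; [exact: g0|exact: ndg].
by apply: nearW => n; exact: mixture_sum_convolution_le.
Qed.

End catalan_mixture.

Local Open Scope ereal_scope.

Theorem mainTheorem5 (R : realType) (d : nat) (hd : (1 <= d)%N)
    (r : R) (hr0 : (0 <= r)%R) (hr1 : (r < 1)%R) :
  exists f : d.-tuple R -> R,
    [/\ (lebesgue_tuple R d).-integrable setT (EFin \o f),
        {ae lebesgue_tuple R d, forall x, (f x)%:E >= convolution f f x},
        \int[lebesgue_tuple R d]_x (f x)%:E = (1 / 2)%:E
      & \int[lebesgue_tuple R d]_x (euclidean_norm x `^ r * f x)%:E < +oo].
Proof.
exists (@mixture R d); split.
- apply/integrableP; split; first by
    apply/measurable_EFinP; exact: measurable_mixture.
  under eq_integral do rewrite /= ger0_norm ?mixture_ge0//.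
  by rewrite integral_mixture_half ltry.
- by apply: aeW => x; exact: mixture_convolution_le.
- by rewrite integral_mixture_half div1r.
- exact: integral_powR_norm_mixture_lty.
Qed.
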